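(* Let $p,q,k$ be positive integers such that $\gcd(p+q,\ell)\leq p$ for every integer $1\leq \ell \leq k$. Then there exists an integer $N=N(p,q,k)$ such that for every integer $n\geq N$ and for all positive integers $b_1\leq b_2 \leq \ldots \leq b_n$ with $b_{N} \leq k$, Enforcer has a winning strategy in the game $mBox(b_1, \ldots, b_n,(p,q))$, both when Enforcer is the first player and when he is the second player.
   Context: A $(p,q)$ Avoider-Enforcer game on a finite board $X$ with a family $\mathcal F\subseteq 2^X$ of target sets is played as follows (strict rules): Avoider and Enforcer alternately claim exactly $p$ and exactly $q$ previously unclaimed elements of $X$ per move, respectively; if before a player's move fewer than $p$ (for Avoider) or $q$ (for Enforcer) unclaimed elements remain, that player claims all of them. It is specified which player moves first. The game ends when all elements are claimed; Avoider loses (Enforcer wins) if at the end Avoider has claimed all elements of some target set, otherwise Avoider wins. The misère box game $mBox(b_1,\ldots,b_n,(p,q))$ is the $(p,q)$ Avoider-Enforcer game (strict rules) whose board is the disjoint union of pairwise disjoint sets (boxes) $B_1,\ldots,B_n$ with $|B_i|=b_i$, and whose target sets are exactly $B_1,\ldots,B_n$. *)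

(* Defs.v *)
From HB Require Import structures.
From mathcomp Require Import all_boot.

Set Implicit Arguments.
Unset Strict Implicit.
Unset Printing Implicit Defensive.

Inductive player := Avoider | Enforcer.

Definition bool_of_player (c : player) : bool :=
  if c is Avoider then true else false.
Definition player_of_bool (x : bool) : player :=
  if x then Avoider else Enforcer.
Lemma bool_of_playerK : cancel bool_of_player player_of_bool.
Proof. by case. Qed.
HB.instance Definition _ := Equality.copy player (can_type bool_of_playerK).

Definition opponent (c : player) : player :=
  if c is Avoider then Enforcer else Avoider.

(* The player making move number t, moves being numbered from 0. *)
Definition mover (first : player) (t : nat) : player :=
  if odd t then opponent first else first.

Section AvoiderEnforcer.

Variables (X : finType) (p q : nat) (F : {set {set X}}) (first : player).

(* A history lists, in chronological order, the set of elements claimed in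
   each of the moves made so far by the two players. *)
Definition history := seq {set X}.

Definition unclaimed (h : history) : {set X} := ~: \bigcup_(m <- h) m.

Definition claimed_by (c : player) (h : history) : {set X} :=
  \bigcup_(t < size h | mover first t == c) nth set0 h t.

Definition quota (c : player) : nat := if c is Avoider then p else q.

Definition game_over (h : history) : Prop := unclaimed h = set0.

(* The minimum encodes the strict rules: exactly the quota is claimed, or all
   the remaining elements if there are fewer than that. *)
Definition legal_move (h : history) (m : {set X}) : Prop :=
  m \subset unclaimed h /\
  #|m| = minn (quota (mover first (size h))) #|unclaimed h|.

Definition legal_history (h : history) : Prop :=
  forall t, t < size h ->
    ~ game_over (take t h) /\ legal_move (take t h) (nth set0 h t).

Definition enforcer_wins (h : history) : Prop :=
  exists2 B, B \in F & B \subset claimed_by Avoider h.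

Definition strategy := history -> {set X}.

Definition follows (c : player) (s : strategy) (h : history) : Prop :=
  forall t, t < size h -> mover first t = c -> nth set0 h t = s (take t h).

(* The first clause makes s legal at every position it can lead to, so that
   the second one is not vacuous. *)
Definition enforcer_winning_strategy (s : strategy) : Prop :=
  (forall h, legal_history h -> follows Enforcer s h -> ~ game_over h ->
     mover first (size h) = Enforcer -> legal_move h (s h)) /\
  (forall h, legal_history h -> follows Enforcer s h -> game_over h ->
     enforcer_wins h).

Definition enforcer_has_winning_strategy : Prop :=
  exists s : strategy, enforcer_winning_strategy s.

End AvoiderEnforcer.

Section MisereBox.

Variables (n : nat) (b : n.-tuple nat).

Definition mBox_board : finType := {i : 'I_n & 'I_(tnth b i)}.

Definition mBox_box (i : 'I_n) : {set mBox_board} := [set x | tag x == i].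

Definition mBox_targets : {set {set mBox_board}} :=
  [set mBox_box i | i : 'I_n].

Definition enforcer_wins_mBox (p q : nat) (first : player) : Prop :=
  enforcer_has_winning_strategy p q mBox_targets first.

End MisereBox.

(* Main.v *)
Require Import Defs.
From mathcomp Require Import all_boot zify.

Set Implicit Arguments.
Unset Strict Implicit.
Unset Printing Implicit Defensive.

(** Fix a family [S] of boxes that Enforcer has not touched, and call waste the
    unclaimed elements outside these boxes. Enforcer always plays in the waste,
    and makes more waste by dropping boxes from [S]. If many boxes of [S] have
    exactly [l] unclaimed elements, then dropping fewer than [p + q] of them
    brings the amount of waste modulo [p + q] below [gcdn (p + q) l <= p]. As
    long as Avoider stays in the waste, each round consumes [p + q] elements of
    it, so eventually fewer than [p] are left and Avoider must claim an element
    of a box of [S]. Repeating this produces many boxes of [S] with fewer than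
    [l] unclaimed elements, and induction on [l] ends with a box claimed
    entirely by Avoider. *)

(** * Preliminaries on finite sets and residues *)

Lemma exists_subset_card (T : finType) (A : {set T}) j :
  j <= #|A| -> exists2 B : {set T}, B \subset A & #|B| = j.
Proof.
elim: j => [|j IHj] le_jA; first by exists set0; rewrite ?sub0set ?cards0.
have [B sBA cB] := IHj (ltnW le_jA).
have /properP[_ [x xA xNB]] : B \proper A by rewrite properEcard sBA cB.
by exists (x |: B); rewrite ?cardsU1 ?xNB ?cB // subUset sub1set xA.
Qed.

(** Modulo [N], the multiples of [L] are those of the gcd [d]. With [N.-1] acting as [-1], the
    chosen multiple cancels [w %/ d * d] and leaves [w %% d]. *)
Lemma exists_small_residue N L w : 0 < N -> 0 < L ->
  exists2 c, c < N & (w + c * L) %% N < gcdn N L.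
Proof.
move=> N0 L0; set d := gcdn N L.
have d0 : 0 < d by rewrite gcdn_gt0 N0.
have [u _ /dvdnP[v Duv]] := Bezoutl N L0.
rewrite gcdnC -/d in Duv.
(* Bezout gives [u * N + d = v * L], so [v * L] is [d] modulo [N]. *)
exists ((v * (w %/ d) * N.-1) %% N); first by rewrite ltn_mod.
rewrite -modnDmr modnMml modnDmr.
have -> : w + v * (w %/ d) * N.-1 * L
          = (w %/ d * d + w %/ d * N.-1 * u) * N + w %% d.
  have -> : v * (w %/ d) * N.-1 * L = (v * L) * (w %/ d * N.-1) by nia.
  rewrite -Duv {1}(divn_eq w d).
  by case: (N) N0 => // N1 _ /=; lia.
rewrite modnMDl modn_small ?ltn_mod //.
by apply: leq_trans (ltn_pmod _ d0) _; rewrite dvdn_leq ?dvdn_gcdl.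
Qed.

(** * Positions won by Enforcer, and strategies extracted from them *)

Section Winning.

Variables (X : finType) (p q : nat) (F : {set {set X}}) (first : player).
Hypotheses (p_gt0 : 0 < p) (q_gt0 : 0 < q).

Implicit Types (h : history X) (m B : {set X}) (S T : {set {set X}}) (L : nat).

Local Notation turn h := (mover first (size h)).
Local Notation claimed := (claimed_by first).
Local Notation legal := (legal_move p q first).

Definition legalb h m : bool :=
  (m \subset unclaimed h) &&
  (#|m| == minn (quota p q (turn h)) #|unclaimed h|).

Lemma legalP h m : reflect (legal h m) (legalb h m).
Proof.
by apply: (iffP andP) => -[sm cm]; split=> //; apply/eqP.
Qed.

(** Backward induction with fuel [d], kept boolean so that a strategy can pick a good move. *)
Fixpoint wins_in d h : bool :=
  if unclaimed h == set0 then [exists B in F, B \subset claimed Avoider h]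
  else if d is d'.+1 then
    if turn h is Avoider then [forall m, legalb h m ==> wins_in d' (rcons h m)]
    else [exists m, legalb h m && wins_in d' (rcons h m)]
  else false.

(** Every move before the end claims something, so this much fuel suffices. Asking for all larger
    values too spares later arguments any bookkeeping of fuel. *)
Definition winning h := forall d, #|unclaimed h| <= d -> wins_in d h.

Lemma unclaimed_rcons h m : unclaimed (rcons h m) = unclaimed h :\: m.
Proof.
by rewrite /unclaimed -cats1 big_cat big_seq1 /= setCU setDE.
Qed.

Lemma claimed_rcons c h m :
  claimed c (rcons h m) = claimed c h :|: (if turn h == c then m else set0).
Proof.
rewrite /claimed_by -!(big_mkord (fun t => mover first t == c)) size_rcons.
rewrite big_mkcond big_nat_recr //= -big_mkcond /= nth_rcons ltnn eqxx.
congr (_ :|: _); rewrite big_nat_cond [RHS]big_nat_cond.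
by apply: eq_bigr => t /andP[/= lt_t _]; rewrite nth_rcons lt_t.
Qed.

Lemma turn_rcons h m : turn (rcons h m) = opponent (turn h).
Proof. by rewrite size_rcons /mover /=; case: odd; case: first. Qed.

Lemma not_claimed_Enforcer h x :
  x \notin unclaimed h -> x \notin claimed Enforcer h ->
  x \in claimed Avoider h.
Proof.
elim/last_ind: h => [|h m IHh].
  by rewrite /unclaimed big_nil setC0 inE.
rewrite unclaimed_rcons !claimed_rcons in_setD !in_setU negb_and negbK !negb_or.
case/orP=> [xm | xU] /andP[xE xmE]; last by rewrite IHh.
by move: xmE; case: (turn h); rewrite ?eqxx /= xm ?orbT.
Qed.

Lemma legal_lt_unclaimed h m : unclaimed h != set0 -> legal h m ->
  #|unclaimed (rcons h m)| < #|unclaimed h|.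
Proof.
move=> U0 [sm cm]; rewrite unclaimed_rcons cardsD (setIidPr sm) cm.
have : 0 < #|unclaimed h| by rewrite card_gt0.
have : 0 < quota p q (turn h) by case: (turn h).
lia.
Qed.

Lemma winning_Avoider h : unclaimed h != set0 -> turn h = Avoider ->
  (forall m, legal h m -> winning (rcons h m)) -> winning h.
Proof.
move=> U0 tA win d le_d; have U1 : 0 < #|unclaimed h| by rewrite card_gt0.
case: d le_d => [|d] le_d; first by lia.
rewrite /= (negPf U0) tA; apply/forallP=> m; apply/implyP=> /legalP lm.
by apply: win => //; have := legal_lt_unclaimed U0 lm; lia.
Qed.

Lemma winning_Enforcer h m : unclaimed h != set0 -> turn h = Enforcer ->
  legal h m -> winning (rcons h m) -> winning h.
Proof.
move=> U0 tE lm win d le_d; have U1 : 0 < #|unclaimed h| by rewrite card_gt0.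
case: d le_d => [|d] le_d; first by lia.
rewrite /= (negPf U0) tE; apply/existsP; exists m; apply/andP; split.
  exact/legalP.
by apply: win => //; have := legal_lt_unclaimed U0 lm; lia.
Qed.

(** What Avoider has claimed only grows, so the outcome is settled and Enforcer may finish with
    arbitrary legal moves. *)
Lemma winning_claimed h B :
  B \in F -> B \subset claimed Avoider h -> winning h.
Proof.
move=> BF; have [n] := ubnP #|unclaimed h|; elim: n h => // n IHn h le_n sB.
have [U0|U0] := eqVneq (unclaimed h) set0.
  have winb : [exists B in F, B \subset claimed Avoider h].
    by apply/existsP; exists B; rewrite BF.
  by case=> [|d] _ /=; rewrite U0 eqxx.
have IH m : legal h m -> winning (rcons h m).
  move=> lm; apply: IHn; first by have := legal_lt_unclaimed U0 lm; lia.
  by rewrite claimed_rcons; apply: subset_trans sB (subsetUl _ _).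
case tE: (turn h); first exact: winning_Avoider.
have [m sm cm] := exists_subset_card (geq_minr q #|unclaimed h|).
have lm : legal h m by split=> //; rewrite tE.
exact: winning_Enforcer U0 tE lm (IH m lm).
Qed.

Lemma winning_strategy : winning [::] ->
  enforcer_has_winning_strategy p q F first.
Proof.
move=> win; pose D := #|unclaimed ([::] : history X)|.
have {}win : wins_in D [::] by exact: win.
(* The value [set0] is only a default: by [step], a good move exists whenever Enforcer has to move
   in a won position. The fuel [(D - size h).-1] is what remains after that move. *)
pose s h := odflt set0
  [pick m | legalb h m && wins_in (D - size h).-1 (rcons h m)].
have step h : wins_in (D - size h) h -> unclaimed h != set0 ->
    turn h = Enforcer ->
    legal h (s h) /\ wins_in (D - (size h).+1) (rcons h (s h)).
  move=> wh U0 tE; rewrite /s subnS.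
  case: pickP => [m /andP[/legalP lm wm] //|none].
  move: wh none; case: (D - size h) => [|d] /=; rewrite (negPf U0) //.
  by rewrite tE => /existsP[m wm] /(_ m); rewrite wm.
(* Plays that follow [s] stay won: moves of Avoider are covered by the universal clause of
   [wins_in], those of Enforcer by the choice of [s]. *)
have inv h : legal_history p q first h -> follows first Enforcer s h ->
    wins_in (D - size h) h.
  elim/last_ind: h => [|h m IHh] lh fh; first by rewrite subn0.
  have pre t : t < size h -> nth set0 (rcons h m) t = nth set0 h t /\
      take t (rcons h m) = take t h.
    by move=> lt_t; rewrite nth_rcons lt_t -cats1 takel_cat // ltnW.
  have wh : wins_in (D - size h) h.
    apply: IHh => t lt_t; have [E1 E2] := pre t lt_t; rewrite -E1 -E2.
      by apply: lh; rewrite size_rcons ltnS ltnW.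
    by apply: fh; rewrite size_rcons ltnS ltnW.
  have last_lt : size h < size (rcons h m) by rewrite size_rcons.
  have tk : take (size h) (rcons h m) = h by rewrite -cats1 take_size_cat.
  have nt : nth set0 (rcons h m) (size h) = m by rewrite nth_rcons ltnn eqxx.
  have := lh _ last_lt; have := fh _ last_lt; rewrite tk nt size_rcons.
  move=> fm [/eqP U0 lm].
  case tE: (turn h); last by rewrite fm //; have [] := step h wh U0 tE.
  rewrite subnS; move: wh; case: (D - size h) => [|d] /=; rewrite (negPf U0) //.
  by rewrite tE => /forallP/(_ m)/implyP; apply; apply/legalP.
exists s; split=> h lh fh.
  by move=> /eqP U0 tE; have [] := step h (inv h lh fh) U0 tE.
move=> U0; have := inv h lh fh.
have -> : wins_in (D - size h) h = [exists B in F, B \subset claimed Avoider h].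
  by case: (D - size h) => [|d] /=; rewrite U0 eqxx.
by case/existsP=> B /andP[BF sB]; exists B.
Qed.

(** * Waste, untouched boxes and the deficit *)

Definition free h B := #|B :&: unclaimed h|.

Definition waste h S := unclaimed h :\: cover S.

Definition untouched h S :=
  S \subset F /\ forall B, B \in S -> [disjoint B & claimed Enforcer h].

(** The level [L] counts unclaimed elements: Avoider may already own part of such a box. *)
Definition full h S (L : nat) := [set B in S | free h B == L].

(** Enforcer's progress at level [L]; it is used when no box of [S] exceeds [L], so that truncation
    loses nothing. *)
Definition deficit h S L := \sum_(B in S) (L - free h B).

Lemma untouchedS h S T : T \subset S -> untouched h S -> untouched h T.
Proof.
move=> sTS [sSF dS]; split; first exact: subset_trans sTS sSF.
by move=> B BT; apply: dS; apply: (subsetP sTS).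
Qed.

Lemma untouched_Avoider h S m : turn h = Avoider ->
  untouched h S -> untouched (rcons h m) S.
Proof.
move=> tA [sSF dS]; split=> // B BS.
by rewrite claimed_rcons tA /= setU0; apply: dS.
Qed.

Lemma untouched_waste h S m :
  m \subset waste h S -> untouched h S -> untouched (rcons h m) S.
Proof.
move=> sm [sSF dS]; split=> // B BS; rewrite claimed_rcons.
case: (turn h == _); rewrite ?setU0; last exact: dS.
apply/pred0P=> x /=; apply/negP=> /andP[xB]; rewrite in_setU.
rewrite (disjointFr (dS B BS) xB) /= => xm.
have := subsetP sm _ xm; rewrite !inE => /andP[/negP[]].
by apply/bigcupP; exists B.
Qed.

Lemma free_rcons_le h m B : free (rcons h m) B <= free h B.
Proof.
by rewrite /free unclaimed_rcons subset_leq_card // setIS // subsetDl.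
Qed.

Lemma free_waste h S m B : m \subset waste h S -> B \in S ->
  free (rcons h m) B = free h B.
Proof.
move=> sm BS; rewrite /free unclaimed_rcons; congr #|pred_of_set _|.
apply/setP=> x; rewrite !inE; case xB: (x \in B) => //=.
case xm: (x \in m) => //=.
have := subsetP sm _ xm; rewrite !inE => /andP[/negP[]].
by apply/bigcupP; exists B.
Qed.

Lemma waste_rcons h S m : m \subset waste h S ->
  #|waste (rcons h m) S| = #|waste h S| - #|m|.
Proof.
move=> sm; rewrite /waste unclaimed_rcons setDDl setUC -setDDl.
by rewrite cardsD (setIidPr sm).
Qed.

Lemma full_drop h S T L : #|full h S L| <= #|full h (S :\: T) L| + #|T|.
Proof.
rewrite -(cardsID T (full h S L)) addnC leq_add //; last first.
  by rewrite subset_leq_card // subsetIr.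
by rewrite subset_leq_card //; apply/subsetP=> B; rewrite !inE => /and3P[-> ->].
Qed.

(** A dropped box contributes [L - L = 0], so making waste costs no progress. *)
Lemma deficit_drop h S T L : T \subset full h S L ->
  deficit h (S :\: T) L = deficit h S L.
Proof.
move=> sT; rewrite /deficit [RHS](big_setID T) /= [X in X + _]big1 // => B.
rewrite inE => /andP[_ /(subsetP sT)]; rewrite inE => /andP[_ /eqP->].
exact: subnn.
Qed.

(** The bound on [free h B] keeps truncation from hiding the loss in [B]; the terms of the other
    boxes cannot decrease. *)
Lemma deficit_touch h S L m B : B \in S -> free h B <= L ->
  ~~ [disjoint B :&: unclaimed h & m] ->
  deficit h S L < deficit (rcons h m) S L.
Proof.
move=> BS le_L meet; rewrite /deficit !(bigD1 B BS) /=.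
have lt_free : free (rcons h m) B < free h B.
  rewrite /free unclaimed_rcons proper_card // properE setIS ?subsetDl //=.
  case/pred0Pn: meet => x /=; rewrite in_setI => /andP[/andP[xB xU] xm].
  by apply/subsetPn; exists x; rewrite ?in_setI ?in_setD ?xB ?xU ?xm.
rewrite -addSn leq_add ?ltn_sub2l ?(leq_trans lt_free) //.
by apply: leq_sum => C _; rewrite leq_sub2l // free_rcons_le.
Qed.

(** This turns a large deficit into many boxes below level [L], since each such box contributes at
    most [L]. *)
Lemma deficit_count h S L :
  deficit h S L <= L * #|[set B in S | free h B < L]|.
Proof.
rewrite /deficit mulnC -sum_nat_const big_mkcond /= [leqRHS]big_mkcond /=.
apply: leq_sum => B _; rewrite inE; case: (B \in S) => //=.
by case: ltnP; rewrite ?leq_subr ?leqn0 ?subn_eq0.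
Qed.

Lemma winning_play_waste h S : turn h = Enforcer -> q <= #|waste h S| ->
  (forall m, m \subset waste h S -> #|m| = q -> winning (rcons h m)) ->
  winning h.
Proof.
move=> tE le_q win; have [m sm cm] := exists_subset_card le_q.
have sWU : waste h S \subset unclaimed h := subsetDl _ _.
have le_qU := leq_trans le_q (subset_leq_card sWU).
apply: (winning_Enforcer (m := m) _ tE); last exact: win.
  by rewrite -card_gt0; lia.
by split; [exact: subset_trans sm sWU | rewrite tE cm /=; lia].
Qed.

(** * Counting with disjoint boxes, and forcing Avoider out of the waste *)

Hypothesis trivF : trivIset F.

Lemma untouched_trivIset h S : untouched h S -> trivIset S.
Proof. by case=> sSF _; apply: trivIsetS trivF. Qed.

Lemma card_unclaimed h S : untouched h S ->
  #|unclaimed h| = #|waste h S| + \sum_(B in S) free h B.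
Proof.
move=> uS; rewrite -(cardsID (cover S) (unclaimed h)) addnC; congr (_ + _).
rewrite -sum1_card.
under eq_bigl => x do rewrite setIC in_setI.
rewrite big_trivIset_cond ?(untouched_trivIset uS) //=.
apply: eq_bigr => B _; rewrite /free -sum1_card.
by apply: eq_bigl => x; rewrite in_setI.
Qed.

(** The unclaimed elements are counted twice, relative to [S] and to [S :\: T]; each dropped box
    hands its [L] elements to the waste. *)
Lemma card_waste_drop h S T L : untouched h S -> T \subset full h S L ->
  #|waste h (S :\: T)| = #|waste h S| + #|T| * L.
Proof.
move=> uS sT.
have sTS : T \subset S.
  by apply: subset_trans sT _; apply/subsetP=> B; rewrite inE => /andP[].
have sumT : \sum_(B in T) free h B = #|T| * L.
  rewrite -sum_nat_const; apply: eq_bigr => B /(subsetP sT).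
  by rewrite inE => /andP[_ /eqP].
apply/eqP; rewrite -(eqn_add2r (\sum_(B in S :\: T) free h B)); apply/eqP.
rewrite -(card_unclaimed (untouchedS (subsetDl S T) uS)) (card_unclaimed uS).
by rewrite (big_setID T) /= (setIidPr sTS) sumT addnA.
Qed.

(** By disjointness an element [x] of [m] spoils at most one box, namely [pblock S x]. *)
Lemma full_touch h S L m : untouched h S ->
  #|full h S L| <= #|full (rcons h m) S L| + #|m|.
Proof.
move=> uS; pose f x := pblock S x.
apply: leq_trans (leq_add (leqnn _) (leq_imset_card f m)).
apply: leq_trans (leq_card_setU _ _); rewrite subset_leq_card //.
apply/subsetP=> B; rewrite !inE => /andP[BS /eqP fB].
rewrite BS /=; have [dB|] := boolP [disjoint B & m].
  apply/orP; left; rewrite -fB /free unclaimed_rcons setDE setIA -setDE.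
  apply/eqP; congr #|pred_of_set _|; apply/setDidPl.
  exact: disjointWl (subsetIl _ _) dB.
case/pred0Pn=> x /= /andP[xB xm].
apply/orP; right; apply/imsetP; exists x => //.
by rewrite /f (def_pblock _ BS) // (untouched_trivIset uS).
Qed.

(** Enforcer's reply when the waste may be too small: since [0 < L], dropping [q] boxes of level [L]
    supplies at least [q] elements of waste. *)
Lemma winning_drop h S L M : 0 < L -> turn h = Enforcer -> untouched h S ->
  M + q <= #|full h S L| ->
  (forall h' S', turn h' = Avoider -> untouched h' S' -> S' \subset S ->
     (forall B, B \in S' -> free h' B = free h B) ->
     deficit h' S' L = deficit h S L -> M <= #|full h' S' L| -> winning h') ->
  winning h.
Proof.
move=> L0 tE uS le_full win.
have [T sT cT] := exists_subset_card (leq_trans (leq_addl M q) le_full).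
have uS' := untouchedS (subsetDl S T) uS.
apply: (winning_play_waste (S := S :\: T) tE).
  by rewrite (card_waste_drop uS sT) cT; nia.
move=> m sm cm; have fr B := free_waste (B := B) sm.
apply: (win _ (S :\: T)); rewrite ?turn_rcons ?tE ?subsetDl //.
- exact: untouched_waste.
- by rewrite -(deficit_drop sT); apply: eq_bigr => B /fr->.
have -> : full (rcons h m) (S :\: T) L = full h (S :\: T) L.
  by apply/setP=> B; rewrite !inE -in_setD; apply: andb_id2l => /fr->.
by have := full_drop h S T L; lia.
Qed.

(* One more unit of deficit can be forced at the price of [p + q] boxes once
   the waste is below [p] modulo [p + q]. *)
Lemma winning_force h S L M D r i : 0 < L ->
  (forall h' S', turn h' = Avoider -> untouched h' S' ->
     (forall B, B \in S' -> free h' B <= L) ->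
     D < deficit h' S' L -> M <= #|full h' S' L| -> winning h') ->
  turn h = Avoider -> untouched h S -> (forall B, B \in S -> free h B <= L) ->
  D <= deficit h S L -> M + (p + q) <= #|full h S L| ->
  r < p -> #|waste h S| = r + i * (p + q) -> winning h.
Proof.
move=> L0 win; elim/ltn_ind: i h S => i IHi h S tA uS leL leD leM lt_r Dw.
have [B0] : exists B, B \in full h S L.
  by apply/set0Pn; rewrite -card_gt0; apply: leq_trans leM; lia.
rewrite inE => /andP[B0S /eqP fB0].
(* Something is unclaimed outside the waste, so a move of Avoider inside the waste cannot be a
   shortened last move. *)
have ltU : #|waste h S| < #|unclaimed h|.
  by rewrite (card_unclaimed uS) (bigD1 B0 B0S) /= fB0; lia.
apply: winning_Avoider => [|//|m [smU]]; first by rewrite -card_gt0; lia.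
rewrite tA /= => cm.
have uS' := untouched_Avoider m tA uS.
have tE : turn (rcons h m) = Enforcer by rewrite turn_rcons tA.
have [smw|] := boolP (m \subset waste h S).
  have le_mw := subset_leq_card smw.
  (* For [i = 0] the waste is [r < p], too small to contain a move of Avoider. Otherwise it has room
     for both moves, and the round lowers [i] by one. *)
  case: i => [|i] in IHi Dw *; first by lia.
  have wm := waste_rcons smw.
  apply: (winning_play_waste (S := S) tE) => [|m' sm' cm']; first by nia.
  have fr B : B \in S -> free (rcons (rcons h m) m') B = free h B.
    by move=> BS; rewrite (free_waste sm' BS) (free_waste smw BS).
  apply: (IHi i) => //.
  - by rewrite turn_rcons tE.
  - exact: untouched_waste sm' uS'.
  - by move=> B BS; rewrite fr // leL.
  - by rewrite /deficit; under eq_bigr => B BS do rewrite fr //.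
  - apply: leq_trans leM _; apply/eq_leq/eq_card => B; rewrite !inE.
    by apply: andb_id2l => BS; rewrite fr.
  - by rewrite waste_rcons // wm; nia.
case/subsetPn=> x xm xw.
have /bigcupP[B BS xB] : x \in cover S.
  by move: xw; rewrite inE (subsetP smU) // andbT negbK.
have ltD : deficit h S L < deficit (rcons h m) S L.
  apply: (deficit_touch BS (leL B BS)); apply/pred0Pn; exists x.
  by rewrite /= inE xB xm (subsetP smU).
(* Avoider's move spoils at most [p] full boxes and the reply drops [q] more, whence the price
   [p + q]. *)
have leM' : M + q <= #|full (rcons h m) S L|.
  by have := full_touch L m uS; lia.
apply: (winning_drop L0 tE uS' leM') => h' S' tA' uS2 sS' fr dE leM2.
apply: (win _ S') => // [C CS'|]; last by rewrite dE; lia.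
rewrite fr //; apply: leq_trans (free_rcons_le _ _ _) (leL C _).
exact: subsetP CS'.
Qed.

(** Here [t] bounds the deficit still missing. Each unit costs at most [2 * (p + q)] full boxes:
    fewer than [p + q] to correct the residue of the waste, then [p + q] to force Avoider. At
    [t = 0], [deficit_count] yields [M0] boxes below level [L]. *)
Lemma winning_deficit L M0 : 0 < L -> gcdn (p + q) L <= p ->
  (forall h S, turn h = Avoider -> untouched h S ->
     (forall B, B \in S -> free h B < L) -> M0 <= #|S| -> winning h) ->
  forall t h S, turn h = Avoider -> untouched h S ->
    (forall B, B \in S -> free h B <= L) ->
    L * M0 <= deficit h S L + t -> t * (2 * (p + q)) <= #|full h S L| ->
    winning h.
Proof.
move=> L0 gcdL win; elim=> [|t IHt] h S tA uS leL leD leM.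
  have sS : [set B in S | free h B < L] \subset S.
    by apply/subsetP=> B; rewrite inE => /andP[].
  apply: win tA (untouchedS sS uS) _ _.
    by move=> B; rewrite inE => /andP[].
  by have := deficit_count h S L; rewrite addn0 in leD; nia.
have pq0 : 0 < p + q by lia.
have [c ltc ltr] := exists_small_residue #|waste h S| pq0 L0.
have [|T sT cT] := @exists_subset_card _ (full h S L) c; first by lia.
have uS' := untouchedS (subsetDl S T) uS.
apply: (winning_force (S := S :\: T) (L := L) (M := t * (2 * (p + q)))
  (D := deficit h S L) (r := (#|waste h S| + c * L) %% (p + q))
  (i := (#|waste h S| + c * L) %/ (p + q))) => //.
- by move=> h' S' tA' uS2 leL' ltD leM'; apply: (IHt h' S') => //; lia.
- by move=> B; rewrite inE => /andP[_]; apply: leL.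
- by rewrite deficit_drop.
- by have := full_drop h S T L; lia.
- exact: leq_trans ltr gcdL.
- by rewrite (card_waste_drop uS sT) cT {1}(divn_eq (_ + _) (p + q)) addnC.
Qed.

End Winning.

(** * Induction on the number of unclaimed elements per box *)

(** The second summand pays [2 * (p + q)] boxes for each of [l'.+1 * box_bound p q l'] units of
    deficit; the first covers boxes already below level [l'.+1]. *)
Fixpoint box_bound (p q l : nat) : nat :=
  if l is l'.+1 then
    box_bound p q l' + l'.+1 * box_bound p q l' * (2 * (p + q))
  else 1.

Lemma winning_many_boxes (X : finType) (p q : nat) (F : {set {set X}})
    (first : player) (l : nat) (h : history X) (S : {set {set X}}) :
  0 < p -> 0 < q -> trivIset F ->
  (forall j, 1 <= j <= l -> gcdn (p + q) j <= p) ->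
  mover first (size h) = Avoider -> untouched F first h S ->
  (forall B, B \in S -> free h B <= l) -> box_bound p q l <= #|S| ->
  winning p q F first h.
Proof.
move=> p0 q0 trivF; elim: l h S => [|l IHl] h S gcdl tA uS leS cS.
  (* At level [0] one box is enough: nothing in it is unclaimed or Enforcer's, so Avoider owns
     it. *)
  have [B BS] : exists B, B \in S by apply/set0Pn; rewrite -card_gt0.
  have [sSF dS] := uS.
  apply: (winning_claimed p0 q0 (B := B)); first exact: subsetP BS.
  apply/subsetP=> x xB; apply: not_claimed_Enforcer; last first.
    by rewrite (disjointFr (dS B BS) xB).
  apply/negP=> xU; have := leS B BS; rewrite leqn0 cards_eq0 => /eqP/setP/(_ x).
  by rewrite in_setI in_set0 xB xU.
have gcdl' j : 1 <= j <= l -> gcdn (p + q) j <= p.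
  by move=> /andP[j0 jl]; apply: gcdl; rewrite j0 ltnW.
have IH h' S' : mover first (size h') = Avoider -> untouched F first h' S' ->
    (forall B, B \in S' -> free h' B < l.+1) -> box_bound p q l <= #|S'| ->
    winning p q F first h'.
  by move=> tA' uS' lt' cS'; apply: (IHl h' S').
have [many|few] := leqP (box_bound p q l) #|[set B in S | free h B < l.+1]|.
  have sS : [set B in S | free h B < l.+1] \subset S.
    by apply/subsetP=> B; rewrite inE => /andP[].
  apply: IH tA (untouchedS sS uS) _ many.
  by move=> B; rewrite inE => /andP[].
have gcdL : gcdn (p + q) l.+1 <= p by apply: gcdl; rewrite leqnn.
(* The current deficit may be zero, so the whole required amount is taken as missing. *)
have := winning_deficit p0 q0 trivF (ltn0Sn l) gcdL IH.
move=> /(_ (l.+1 * box_bound p q l) h S); apply=> //; first exact: leq_addl.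
have sSU : #|S| <= #|[set B in S | free h B < l.+1]| + #|full h S l.+1|.
  apply: leq_trans (leq_card_setU _ _); rewrite subset_leq_card //.
  apply/subsetP=> B BS; rewrite !inE BS /= orbC -leq_eqVlt.
  exact: leS.
rewrite /= in cS; have := leq_trans cS sSU; move: few.
set a := #|[set _ in S | _]|; set f := #|full _ _ _|.
lia.
Qed.

(** * The misère box game *)

Section Boxes.

Variables (n : nat) (b : n.-tuple nat).
Hypothesis b_gt0 : forall i, 0 < tnth b i.

Lemma card_mBox_box i : #|mBox_box b i| = tnth b i.
Proof.
pose f (x : 'I_(tnth b i)) : mBox_board b := Tagged _ x.
have f_inj : injective f by move=> x y; apply: eq_from_Tagged.
rewrite -[RHS]card_ord -(card_imset _ f_inj); apply: eq_card => u; rewrite inE.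
apply/eqP/imsetP => [ui|[y _ -> //]].
by exists (etagged ui) => //; rewrite /f etaggedK.
Qed.

(** Positive sizes matter here: empty boxes would coincide as sets. *)
Lemma mBox_box_inj : injective (mBox_box b).
Proof.
move=> i j /setP E; apply/eqP.
have := E (Tagged (fun i => 'I_(tnth b i)) (Ordinal (b_gt0 i))).
by rewrite !inE /= eqxx.
Qed.

Lemma trivIset_mBox : trivIset (mBox_targets b).
Proof.
apply/trivIsetP=> _ _ /imsetP[i _ ->] /imsetP[j _ ->] neq.
apply/pred0P=> x /=; rewrite !inE; apply: contraNF neq => /andP[/eqP-> /eqP->].
exact: eqxx.
Qed.

End Boxes.

Theorem theorem1p3 (p q k : nat) (hp : 0 < p) (hq : 0 < q) (hk : 0 < k)
    (hgcd : forall l : nat, 1 <= l <= k -> gcdn (p + q) l <= p) :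
  exists2 N : nat, 0 < N &
    forall (n : nat) (b : n.-tuple nat),
      N <= n ->
      (forall i : 'I_n, 0 < tnth b i) ->
      (forall i j : 'I_n, i <= j -> tnth b i <= tnth b j) ->
      nth 0 b N.-1 <= k ->
      enforcer_wins_mBox b p q Enforcer /\ enforcer_wins_mBox b p q Avoider.
Proof.
(* The extra [q] boxes serve Enforcer's opening move when he plays first. *)
exists (box_bound p q k + q); first by lia.
set N := _ + q => n b leNn b0 mono bN.
have trivF := trivIset_mBox b.
(* Only these boxes are known to have size at most [k]; all others are waste from the outset. *)
pose S := [set mBox_box b i | i : 'I_n & i < N].
have cS : #|S| = N.
  rewrite card_imset; last exact: mBox_box_inj.
  rewrite -sum1dep_card -(big_ord_widen _ (fun=> 1) leNn).
  by rewrite sum1_card card_ord.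
have U0 : unclaimed ([::] : history (mBox_board b)) = setT.
  by rewrite /unclaimed big_nil setC0.
have free0 (B : {set mBox_board b}) : free [::] B = #|B|.
  by rewrite /free U0 setIT.
have N0 : 0 < N by rewrite /N; lia.
have szB B : B \in S -> 0 < free [::] B <= k.
  case/imsetP=> i lti ->; rewrite inE in lti.
  rewrite free0 card_mBox_box b0 /=; apply: leq_trans bN.
  have ltN : N.-1 < n by lia.
  have := mono i (Ordinal ltN); rewrite (tnth_nth 0 b (Ordinal _)); apply.
  by rewrite /=; lia.
have uS first : untouched (mBox_targets b) first [::] S.
  split=> [|B _]; last by rewrite /claimed_by big_ord0 -setI_eq0 setI0.
  by apply/subsetP=> _ /imsetP[i _ ->]; apply: imset_f.
split; apply: winning_strategy; last first.
  apply: (winning_many_boxes (S := S) (l := k)) => //; last first.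
    by rewrite cS leq_addr.
  by move=> B /szB/andP[].
(* When Enforcer starts, [q] nonempty boxes are dropped to make room for his first move, and
   [box_bound p q k] boxes remain. *)
have [T sT cT] : exists2 T : {set {set mBox_board b}}, T \subset S & #|T| = q.
  by apply: exists_subset_card; rewrite cS leq_addl.
have uS' := untouchedS (subsetDl S T) (uS Enforcer).
apply: (winning_play_waste hp hq (S := S :\: T)) => //.
  have := card_unclaimed trivF uS'; rewrite (card_unclaimed trivF (uS Enforcer)).
  rewrite (big_setID T) /= (setIidPr sT) addnA => /addIn <-.
  rewrite -cT -sum1_card; apply: leq_trans (leq_addl _ _).
  by apply: leq_sum => B /(subsetP sT)/szB/andP[].
move=> m sm cm; have uS2 := untouched_waste sm uS'.
apply: (winning_many_boxes (S := S :\: T) (l := k)) => // [B BS|].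
  rewrite (free_waste sm BS); move: BS; rewrite inE => /andP[_ /szB].
  by case/andP.
by rewrite cardsD (setIidPr sT) cS cT /N addnK.
Qed.
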